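(* Let $L>0$ and $M>0$, and let $v:[0,L]\to[0,M]$ be absolutely continuous with $v(0)=0$ and $v(L)=M$. Suppose that $\sqrt v$ is concave and nondecreasing on $[0,L]$ and that $$v'(x)^2\le2\,(M-v(x))\quad\text{for a.e. }x\in[0,L].$$ Then $$\int_0^L\bigl(2v-v'^2\bigr)\,dx\ge\frac{2M}{3}\,L .$$ *)

(* Defs.v *)
From mathcomp Require Import all_boot all_order all_algebra.
From mathcomp Require Import all_classical all_reals all_analysis.

Set Implicit Arguments.
Unset Strict Implicit.
Unset Printing Implicit Defensive.

Import Order.TTheory GRing.Theory Num.Theory.
Import numFieldNormedType.Exports.

Local Open Scope classical_set_scope.
Local Open Scope ring_scope.
Local Open Scope convex_scope.

(* The subintervals [(B i).1, (B i).2] are nonoverlapping: only their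
   interiors are required to be pairwise disjoint, and degenerate ones are
   allowed (they contribute 0 to both sums). *)
Definition absolutely_continuous_on (R : realType) (a b : R) (f : R -> R) : Prop :=
  forall e : R, 0 < e ->
  exists2 d : R, 0 < d &
  forall (n : nat) (B : 'I_n -> R * R),
    (forall i, [/\ a <= (B i).1, (B i).1 <= (B i).2 & (B i).2 <= b]) ->
    trivIset [set: 'I_n] (fun i => `](B i).1, (B i).2[%classic) ->
    \sum_(i < n) ((B i).2 - (B i).1) < d ->
    \sum_(i < n) `|f (B i).2 - f (B i).1| < e.

(* Mirror image of [convex_function]; [x <| t |> y] is [t x + (1 - t) y]. *)
Definition concave_function (R : numFieldType) (E : lmodType R)
    (E' := convex_lmodType E) (D : set E') (f : E' -> R^o) : Prop :=
  forall t : {i01 R},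
    {in D &, forall x y : E', (f x <| t |> f y <= f (x <| t |> y))%R}.

(* Main.v *)
(* Write [w = sqrt v] and let [p] be the right derivative of [w], which is
   nonnegative and nonincreasing by concavity. Since [v' = 2 w p] almost
   everywhere, the hypothesis becomes [2 w^2 p^2 <= M - w^2]. The potential
     P(w, p) = 2/3 (w^3 - M w) / p - 4/3 w^3 p
   satisfies [P_w = (2 w^2 - 4 w^2 p^2 - 2/3 M) / p], so along the curve
   [(w, p)] the term [P_w dw] is the integrand minus its claimed mean, and
   [P_p = 2/3 w ((M - w^2) / p^2 - 2 w^2)] is nonnegative under the hypothesis,
   so [P_p dp <= 0] as [p] decreases. Hence [P(b) - P(a)] is at most the
   integral over [[a, b]] of the integrand minus [2/3 M]. Moreover [P(a) <= 0],
   and [P(b)] tends to 0 when [b] tends to the first point where [v = M];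
   beyond that point the integrand is [2 M]. Since [p] may jump, the chain rule
   is replaced by finite increments whose errors are [O((y - x) (g y - g x))]
   with [g = w - p] nondecreasing, and these vanish on fine partitions. *)
Require Import Defs.
From mathcomp Require Import all_boot all_order all_algebra.
From mathcomp Require Import all_classical all_reals all_analysis.
From mathcomp Require Import measurable_realfun ring lra.

Import Order.TTheory GRing.Theory Num.Theory.
Import numFieldNormedType.Exports.

Set Implicit Arguments.
Unset Strict Implicit.
Unset Printing Implicit Defensive.

Local Open Scope classical_set_scope.
Local Open Scope ring_scope.

(** * Finite-increment comparison and increments of the potential *)

(** On [n] equal pieces both sides telescope, so [h b - h a] is at most [(b - a) / n * (g b - g a)]
    for every [n]. Jumps of [g] do no harm, since only its total increment enters. *)
Lemma ler_of_subquadratic_increments (R : realType) (g h : R -> R) (a b : R) :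
  a <= b ->
  (forall x y, a <= x -> x < y -> y <= b ->
     h y - h x <= (y - x) * (g y - g x)) ->
  h b <= h a.
Proof.
move=> ab hg; have [->//|neq_ab] := eqVneq a b.
have lt_ab : a < b by rewrite lt_neqAle neq_ab.
have step (n : nat) : (0 < n)%N ->
    h b - h a <= (b - a) / n%:R * (g b - g a).
  move=> n0; have n0' : (0 : R) < n%:R by rewrite ltr0n.
  pose x i := a + (b - a) / n%:R * i%:R.
  have x0 : x 0%N = a by rewrite /x mulr0 addr0.
  have xn : x n = b by rewrite /x divfK ?lt0r_neq0// addrC subrK.
  have dx i : x i.+1 - x i = (b - a) / n%:R.
    by rewrite /x -natr1; ring.
  have d0 : 0 < (b - a) / n%:R by rewrite divr_gt0// subr_gt0.
  rewrite -xn -x0 -(telescope_sumr (h \o x) (leq0n n)).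
  rewrite -(telescope_sumr (g \o x) (leq0n n)) mulr_sumr.
  rewrite [leLHS]big_seq [leRHS]big_seq ler_sum// => i.
  rewrite mem_index_iota => /andP[_ ilt] /=; rewrite x0 xn -(dx i).
  apply: hg.
  - by rewrite /x lerDl mulr_ge0// ltW.
  - by rewrite -subr_gt0 dx.
  - by rewrite -xn /x lerD2l ler_wpM2l ?ler_nat// ltW.
rewrite leNgt; apply/negP => lt_h.
pose e := h b - h a; have e0 : 0 < e by rewrite subr_gt0.
pose c := (b - a) * (g b - g a).
have := step (Num.truncn `|c / e|).+1 isT.
have := truncnS_gt `|c / e|; set N := (X in X%:R) => cN.
have N0 : (0 : R) < N%:R by rewrite ltr0n.
rewrite mulrAC -/c -/e ler_pdivlMr// leNgt => /negP; apply.
by rewrite mulrC -ltr_pdivrMr// (le_lt_trans (ler_norm _)).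
Qed.

Definition potential {R : realType} (M w p : R) : R :=
  2 / 3 * (w ^+ 3 - M * w) / p - 4 / 3 * w ^+ 3 * p.

(** The move from [(w, p)] to [(w1, p1)] is split in two: first [p] drops with [w] frozen, which
    cannot raise the potential, then [w] grows with [p1] frozen. [K] bounds all quantities at once,
    making the error constant uniform over a partition. *)
Lemma potential_step (R : realType) (K M w w1 p p1 d : R) :
  0 <= d -> 0 <= w -> w <= w1 -> w1 <= K -> M <= K -> w1 ^+ 2 <= M ->
  0 < p1 -> p1 <= p -> p <= K -> p1^-1 <= K ->
  2 * w ^+ 2 * p ^+ 2 <= M - w ^+ 2 ->
  p1 * d <= w1 - w -> w1 - w <= p * d ->
  potential M w1 p1 - potential M w p <=
    d * (2 * w ^+ 2 - 4 * (w1 ^+ 2 * p ^+ 2) - 2 * M / 3)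
    + d * ((4 / 3 * K ^+ 2 + 4 * K + 8 * K ^+ 3) * ((w1 - w) + (p - p1))).
Proof.
move=> d0 w0 ww1 w1K MK w1M p10 pp1 pK p1K wpM lo hi.
have p0 : 0 < p := lt_le_trans p10 pp1.
have K0 : 0 <= K by rewrite (le_trans _ pK)// ltW.
have w10 : 0 <= w1 by rewrite (le_trans w0).
have M0 : 0 <= M by rewrite (le_trans _ w1M)// sqr_ge0.
have w2 : w ^+ 2 <= w1 ^+ 2 by rewrite lerXn2r.
have ww2 : w * w1 <= w1 ^+ 2 by rewrite expr2 ler_wpM2r.
have ww3 : w ^+ 2 <= w * w1 by rewrite expr2 ler_wpM2l.
have decr : potential M w p1 - potential M w p <= 0.
  have -> : potential M w p1 - potential M w p =
      2 / 3 * (w * (p - p1)) * (2 * w ^+ 2 - (M - w ^+ 2) / (p * p1)).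
    by rewrite /potential; field; rewrite !gt_eqF.
  apply: mulr_ge0_le0.
    by rewrite mulr_ge0 ?divr_ge0// mulr_ge0// subr_ge0.
  rewrite subr_le0.
  rewrite ler_pdivlMr ?mulr_gt0// (le_trans _ wpM)// ler_wpM2l//.
    by rewrite mulr_ge0// sqr_ge0.
  by rewrite expr2 ler_wpM2l// ltW.
(* [T / p1] is the difference quotient of the potential in [w] at fixed [p1]. *)
pose S := w1 ^+ 2 + w * w1 + w ^+ 2.
pose T := 2 / 3 * (S - M) - 4 / 3 * S * p1 ^+ 2.
pose q := (w1 - w) / p1.
have incr : potential M w1 p1 - potential M w p1 = q * T.
  by rewrite /potential /q /T /S; field; rewrite gt_eqF.
(* [q] is the time needed to climb from [w] to [w1] at speed [p1]. It exceeds the true time [d] by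
   an error of order [d * (p - p1)]; as [q - d] is nonnegative, an upper bound on [T] suffices for
   that excess. *)
have dq : 0 <= q - d by rewrite subr_ge0 ler_pdivlMr// mulrC.
have qd : q - d <= d * (K * (p - p1)).
  have : q <= p * d / p1 by rewrite ler_pM2r ?invr_gt0.
  have -> : p * d / p1 = d + d * (p1^-1 * (p - p1)) by field; rewrite gt_eqF.
  have : d * (p1^-1 * (p - p1)) <= d * (K * (p - p1)).
    by rewrite ler_wpM2l// ler_wpM2r// subr_ge0.
  lra.
have S0 : 0 <= S by rewrite !addr_ge0 ?sqr_ge0 ?mulr_ge0.
have TM : T <= 4 / 3 * K.
  have : 0 <= S * p1 ^+ 2 by rewrite mulr_ge0 ?sqr_ge0.
  by rewrite /T /S; lra.
have qdT : (q - d) * T <= d * (K * (p - p1)) * (4 / 3 * K).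
  apply: (@le_trans _ _ ((q - d) * (4 / 3 * K))); first exact: ler_wpM2l.
  by rewrite ler_wpM2r// mulr_ge0// divr_ge0.
have wK : w1 ^+ 2 - w ^+ 2 <= 2 * K * (w1 - w).
  rewrite subr_sqr mulrC ler_wpM2r ?subr_ge0//; lra.
have wpK : w1 ^+ 2 * p ^+ 2 - w ^+ 2 * p1 ^+ 2 <=
    2 * K ^+ 3 * ((w1 - w) + (p - p1)).
  rewrite -!exprMn subr_sqr mulrC.
  have w1p : w1 * p <= K * K by rewrite ler_pM// ltW.
  have wp1 : w * p1 <= K * K.
    by rewrite ler_pM// ?(ltW p10) ?(le_trans ww1) ?(le_trans pp1).
  have A : w1 * p - w * p1 <= K * ((w1 - w) + (p - p1)).
    have : (w1 - w) * p <= (w1 - w) * K by rewrite ler_wpM2l// subr_ge0.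
    have : w * (p - p1) <= K * (p - p1).
      by rewrite ler_wpM2r ?subr_ge0// (le_trans ww1).
    lra.
  have B : 0 <= w1 * p - w * p1 by rewrite subr_ge0 ler_pM// ltW.
  have -> : 2 * K ^+ 3 * (w1 - w + (p - p1)) =
    (2 * (K * K)) * (K * (w1 - w + (p - p1))) by ring.
  rewrite ler_pM//; last lra.
  by rewrite addr_ge0 ?mulr_ge0 ?(ltW p0) ?(ltW p10).
have TT : T <= 2 * w ^+ 2 - 4 * (w1 ^+ 2 * p ^+ 2) - 2 * M / 3
    + (4 * K + 8 * K ^+ 3) * ((w1 - w) + (p - p1)).
  have : w ^+ 2 * p1 ^+ 2 * 3 <= S * p1 ^+ 2.
    rewrite mulrAC ler_wpM2r ?sqr_ge0// /S; lra.
  have : 0 <= K * (p - p1) by rewrite mulr_ge0// subr_ge0.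
  by rewrite /T /S; lra.
have := ler_wpM2l d0 TT.
have : 0 <= d * (K ^+ 2 * (w1 - w)).
  by rewrite !mulr_ge0 ?sqr_ge0// subr_ge0.
move: decr incr qdT; lra.
Qed.

(** * Chord slopes and one-sided derivatives of a concave function *)

Definition slope {R : realType} (w : R -> R) (x y : R) : R :=
  (w y - w x) / (y - x).

(* At [x = L] the set is empty and the value is [0]. *)
Definition right_slope {R : realType} (L : R) (w : R -> R) (x : R) : R :=
  sup (slope w x @` `]x, L]).

(* The left derivative of [w] exceeds the right one. *)
Definition kinks {R : realType} (L : R) (w : R -> R) : set R :=
  [set x | 0 < x < L /\ exists2 r, right_slope L w x < r &
    forall y, 0 <= y -> y < x -> r <= slope w y x].

Section concave_slopes.
Context {R : realType}.
Variables (L : R) (w : R -> R).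
Hypothesis w_concave : forall x y z : R, 0 <= x -> x < y -> y < z -> z <= L ->
  (w z - w y) * (y - x) <= (w y - w x) * (z - y).
Hypothesis w_homo : forall x y : R, 0 <= x -> x <= y -> y <= L -> w x <= w y.

Lemma slope_decr (x y z : R) : 0 <= x -> x < y -> y < z -> z <= L ->
  slope w y z <= slope w x y /\
  slope w y z <= slope w x z <= slope w x y.
Proof.
move=> x0 xy yz zL; have := w_concave x0 xy yz zL.
have xz := lt_trans xy yz.
move=> H; split; [|apply/andP; split]; rewrite /slope;
  rewrite ler_pdivrMr ?subr_gt0// mulrAC ler_pdivlMr ?subr_gt0//; nra.
Qed.

Lemma slope_ge0 (x y : R) : 0 <= x -> x < y -> y <= L -> 0 <= slope w x y.
Proof.
move=> x0 xy yL; rewrite /slope divr_ge0// subr_ge0; last exact: ltW.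
by rewrite w_homo// ltW.
Qed.

Lemma right_slope_has_ubound (x : R) : 0 < x ->
  has_ubound (slope w x @` `]x, L]).
Proof.
move=> x0; exists (slope w 0 x) => _ [y /= + <-].
by rewrite in_itv/= => /andP[xy yL]; case: (slope_decr (lexx 0) x0 xy yL).
Qed.

Lemma slope_le_right (x y : R) : 0 < x -> x < y -> y <= L ->
  slope w x y <= right_slope L w x.
Proof.
move=> x0 xy yL; apply: (ub_le_sup (right_slope_has_ubound x0)).
by exists y => //=; rewrite in_itv/= xy.
Qed.

Lemma right_slope_le (x y : R) : 0 <= x -> x < y -> y <= L ->
  right_slope L w y <= slope w x y.
Proof.
move=> x0 xy; rewrite le_eqVlt => /predU1P[yL|yL].
  by rewrite /right_slope yL set_itvoc0 image_set0 sup0 -yL slope_ge0// yL.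
apply: ge_sup; first by exists (slope w y L), L => //=; rewrite in_itv/= yL/=.
move=> _ [z /= + <-]; rewrite in_itv/= => /andP[yz zL].
by case: (slope_decr x0 xy yz zL).
Qed.

Lemma right_slope_ge0 (x : R) : 0 < x -> x <= L -> 0 <= right_slope L w x.
Proof.
move=> x0; rewrite le_eqVlt => /predU1P[->|xL].
  by rewrite /right_slope set_itvoc0 image_set0 sup0.
exact: le_trans (slope_ge0 (ltW x0) xL (lexx L)) (slope_le_right x0 xL (lexx L)).
Qed.

Lemma right_slope_anti (x y : R) : 0 < x -> x <= y -> y <= L ->
  right_slope L w y <= right_slope L w x.
Proof.
move=> x0; rewrite le_eqVlt => /predU1P[->//|xy yL].
exact: le_trans (right_slope_le (ltW x0) xy yL) (slope_le_right x0 xy yL).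
Qed.

(** Each kink gets a rational strictly between its right slope and all its left chord slopes. The
    chord joining two kinks separates their gaps, so this choice is injective. *)
Lemma countable_kinks : countable (kinks L w).
Proof.
have q_ex (x : R) : exists q : rat, kinks L w x ->
    right_slope L w x < ratr q /\
    forall y, 0 <= y -> y < x -> ratr q < slope w y x.
  have [[_ [r lo hi]]|nk] := pselect (kinks L w x); last by exists 0.
  have [q] := rat_in_itvoo lo; rewrite in_itv/= => /andP[xq qr].
  by exists q => _; split => // y y0 yx; rewrite (lt_le_trans qr)// hi.
have [q qP] := choice q_ex.
apply: (@sub_countable _ _ _ [set: rat]); last exact: countableP.
apply/pcard_leTP/injPex; exists q => // x y /set_mem kx /set_mem ky qxy.
wlog xy : x y kx ky qxy / x < y.
  by move=> H; have [xy|yx|//] := ltgtP x y; [|apply/esym]; exact: H.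
have [/andP[x0 _] _] := kx; have [/andP[_ yL] _] := ky.
have [xq _] := qP _ kx; have [_ /(_ x (ltW x0) xy)] := qP _ ky.
rewrite -qxy => /(lt_trans xq); rewrite ltNge slope_le_right//.
exact: ltW.
Qed.

(** Some right chord has slope above [p - e] and, without a kink, some left chord has slope below
    [p + e]. Monotonicity of slopes then traps every difference quotient taken between their far
    ends [y0] and [y1]. *)
Lemma is_derive_right_slope (x : R) : 0 < x -> x < L -> ~ kinks L w x ->
  is_derive x 1 w (right_slope L w x).
Proof.
move=> x0 xL nk; set p := right_slope L w x.
have : h^-1 *: (w (h + x) - w x) @[h --> (0:R)^'] --> p.
  apply/cvgrPdist_le => /= e e0.
  have [_ [y1 /= + <-] y1p] : exists2 s, (slope w x @` `]x, L]) s & p - e < s.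
    apply: sup_adherent => //; split; last exact: right_slope_has_ubound.
    by exists (slope w x L), L => //=; rewrite in_itv/= xL/=.
  rewrite in_itv/= => /andP[xy1 y1L].
  have [y0 [y00 y0x y0p]] : exists y, [/\ 0 <= y, y < x & slope w y x < p + e].
    apply: contrapT => H; apply: nk; split; first by rewrite x0.
    exists (p + e); first by rewrite ltrDl.
    by move=> y y0 yx; rewrite leNgt; apply/negP => ?; apply: H; exists y.
  exists (Num.min (y1 - x) (x - y0)) => /=.
    by rewrite lt_min !subr_gt0 xy1.
  move=> h /=; rewrite sub0r normrN lt_min => /andP[h1 h2] h0.
  rewrite [_ *: _]mulrC.
  have [hneg|hpos|h00] := ltgtP h 0; last by rewrite h00 eqxx in h0.
    have hx : h + x < x by rewrite gtrDr.
    have y0h : y0 < h + x by move: h2; rewrite ltr0_norm//; lra.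
    have -> : (w (h + x) - w x) / h = slope w (h + x) x.
      by rewrite /slope opprD addrCA subrr addr0 invrN mulrN -mulNr opprB.
    have lo : p <= slope w (h + x) x.
      by rewrite right_slope_le// ?(ltW xL)// (le_trans y00)// ltW.
    have [_ /andP[hi _]] := slope_decr y00 y0h hx (ltW xL).
    by rewrite ler_distlC; lra.
  have hx : x < h + x by rewrite ltrDr.
  have y1h : h + x < y1 by move: h1; rewrite gtr0_norm//; lra.
  have -> : (w (h + x) - w x) / h = slope w x (h + x).
    by rewrite /slope addrK.
  have hi : slope w x (h + x) <= p.
    by rewrite slope_le_right// (le_trans _ y1L)// ltW.
  have [_ /andP[_ lo]] := slope_decr (ltW x0) hx y1h y1L.
  by rewrite ler_distlC; lra.
move=> cv; apply: DeriveDef.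
  apply/cvg_ex; exists p; move: cv; apply: cvg_trans; apply: near_eq_cvg.
  by near=> h; rewrite [h *: _]mulr1.
rewrite /derive; apply: cvg_lim => //; move: cv; apply: cvg_trans.
by apply: near_eq_cvg; near=> h; rewrite [h *: _]mulr1.
Unshelve. all: by end_near. Qed.

End concave_slopes.

(** * Measurability, null sets and elementary integral bounds *)

Lemma nondecreasing_on_measurable (R : realType) (i : interval R) (f : R -> R) :
  (forall x y, x \in i -> y \in i -> x <= y -> f x <= f y) ->
  measurable_fun [set` i] f.
Proof.
move=> f_nd.
apply: (measurability (@RGenCInfty.G R)) => [|/= _ [_] [r] -> <-].
  exact: RGenCInfty.measurableE.
apply: is_interval_measurable => s t /= [si]; rewrite in_itv/= andbT => rs.
move=> [ti _] u sut; have [su ut] := andP sut.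
have ui : u \in i := interval_is_interval si ti sut.
by split => //; rewrite in_itv/= andbT (le_trans rs)// f_nd.
Qed.

(** This serves for the derivative of [v], whose value is identified only off a countable set:
    preimages change by a countable, hence measurable, set. *)
Lemma measurable_fun_setD_countable (R : realType) (D A : set R) (f : R -> R) :
  measurable D -> countable A -> measurable_fun (D `\` A) f ->
  measurable_fun D f.
Proof.
move=> mD cA mf _ Y mY.
have mc (B : set R) : countable B -> measurable B.
  by apply: countable_measurable => t; exact: measurable_set1.
have -> : D `&` f @^-1` Y =
    ((D `\` A) `&` f @^-1` Y) `|` (A `&` (D `&` f @^-1` Y)).
  apply/seteqP; split => x.
    by move=> [Dx Yx]; have [Ax|nAx] := pselect (A x); [right|left].
  by move=> [[[Dx _] Yx]|[_ [Dx Yx]]].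
apply: measurableU; first by apply: mf => //; apply: measurableD => //; exact: mc.
by apply: mc; apply: sub_countable cA; apply: subset_card_le => x [].
Qed.

Lemma ae_itv_ex (R : realType) (P : R -> Prop) (a b : R) :
  {ae @lebesgue_measure R, forall x, P x} -> a < b ->
  exists x, [/\ a < x, x < b & P x].
Proof.
move=> [N [mN N0 PN]] ab; apply: contrapT => nP.
have sub : `]a, b[ `<=` N.
  move=> x /=; rewrite in_itv/= => /andP[ax xb]; apply: PN => /= Px.
  by apply: nP; exists x.
have : (@lebesgue_measure R `]a, b[%classic <= 0)%E.
  by rewrite -N0 le_measure// inE.
by rewrite lebesgue_measure_itv/= lte_fin ab -EFinD lee_fin leNgt subr_gt0 ab.
Qed.

Lemma absolutely_continuous_on_uniform (R : realType) (a b : R) (f : R -> R) :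
  absolutely_continuous_on a b f ->
  forall e : R, 0 < e -> exists2 d : R, 0 < d &
    forall x y : R, a <= x -> x <= y -> y <= b -> y - x < d -> `|f y - f x| < e.
Proof.
move=> ac e /ac[d d0 H]; exists d => // x y ax xy yb xyd.
have := H 1%N (fun=> (x, y)); rewrite !big_ord1/=; apply => //.
by move=> i j _ _ _; rewrite !ord1.
Qed.

Lemma Rintegral_ge_cst (R : realType) (f : R -> R) (c x y : R) :
  x <= y ->
  (@lebesgue_measure R).-integrable `]x, y] (EFin \o f) ->
  (forall t, x < t -> t < y -> c <= f t) ->
  c * (y - x) <= \int[@lebesgue_measure R]_(t in `]x, y]) f t.
Proof.
move=> xy fi cf.
have fi' : (@lebesgue_measure R).-integrable `]x, y[ (EFin \o f).
  by apply: integrableS fi => //; apply: subset_itvl; rewrite bnd_simp.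
have -> : c * (y - x) = \int[@lebesgue_measure R]_(t in `]x, y[) c.
  rewrite Rintegral_cst//= lebesgue_measure_itv/= lte_fin.
  have [->|nxy] := eqVneq x y; first by rewrite ltxx subrr.
  by rewrite lt_neqAle nxy xy -EFinD.
rewrite -Rintegral_itv_bndo_bndc//; apply: le_Rintegral => //.
  apply: measurable_bounded_integrable => //=; last exact: bounded_cst.
  by rewrite lebesgue_measure_itv//=; case: ifPn => // _; rewrite -EFinB ltry.
by move=> t /=; rewrite in_itv/= => /andP[]; exact: cf.
Qed.

(* With [v = w ^+ 2] and [p = w^`()], this is [2 v - v^`() ^+ 2]. *)
Definition energy {R : realType} (w p : R -> R) (x : R) : R :=
  2 * w x ^+ 2 - 4 * (w x ^+ 2 * p x ^+ 2).

(** * The energy bound for a curve [w] with right derivative [p] *)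

Section energy_bound.
Context {R : realType}.
Variables (L M : R) (w p : R -> R).
Hypothesis L_gt0 : 0 < L.
Hypothesis M_gt0 : 0 < M.
Hypothesis w_ge0 : forall x : R, 0 <= x -> x <= L -> 0 <= w x.
Hypothesis w_homo : forall x y : R, 0 <= x -> x <= y -> y <= L -> w x <= w y.
Hypothesis w0 : w 0 = 0.
Hypothesis wL : w L ^+ 2 = M.
Hypothesis w_unif : forall e : R, 0 < e -> exists2 d : R, 0 < d &
  forall x y : R, 0 <= x -> x <= y -> y <= L -> y - x < d ->
    w y ^+ 2 - w x ^+ 2 < e.
Hypothesis p_ge0 : forall x : R, 0 < x -> x <= L -> 0 <= p x.
Hypothesis p_anti : forall x y : R, 0 < x -> x <= y -> y <= L -> p y <= p x.
Hypothesis p_lo : forall x y : R, 0 < x -> x < y -> y <= L ->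
  p y * (y - x) <= w y - w x.
Hypothesis p_hi : forall x y : R, 0 < x -> x < y -> y <= L ->
  w y - w x <= p x * (y - x).
Hypothesis wp : forall x : R, 0 < x -> x <= L ->
  2 * w x ^+ 2 * p x ^+ 2 <= M - w x ^+ 2.

Let mu := @lebesgue_measure R.
Let I (x y : R) := \int[mu]_(t in `]x, y]) energy w p t.

Let w2_homo (x y : R) : 0 <= x -> x <= y -> y <= L -> w x ^+ 2 <= w y ^+ 2.
Proof.
move=> x0 xy yL; have x0' := w_ge0 x0 (le_trans xy yL).
by rewrite lerXn2r ?w_homo// nnegrE (le_trans x0')// w_homo.
Qed.

Let w2M (x : R) : 0 <= x -> x <= L -> w x ^+ 2 <= M.
Proof. by move=> x0 xL; rewrite -wL w2_homo. Qed.

(** Both [w] and [p] are monotone. The point [0] is left out because chord slopes from it may be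
    unbounded. *)
Lemma measurable_energy : measurable_fun `]0, L] (energy w p).
Proof.
have mw : measurable_fun `]0, L] w.
  apply: nondecreasing_on_measurable => x y; rewrite !in_itv/=.
  by move=> /andP[/ltW x0 _] /andP[_ yL] xy; exact: w_homo.
have mp : measurable_fun `]0, L] p.
  rewrite -(opprK p); apply/measurable_funN.
  apply: nondecreasing_on_measurable => x y; rewrite !in_itv/=.
  by move=> /andP[x0 _] /andP[_ yL] xy; rewrite lerN2 p_anti.
apply: measurable_funB.
  by apply: measurable_funM => //; exact: measurable_funX.
apply: measurable_funM => //.
by apply: measurable_funM; exact: measurable_funX.
Qed.

Let energy_ge (x : R) : 0 < x -> x <= L -> 4 * w x ^+ 2 - 2 * M <= energy w p x.
Proof. by move=> x0 xL; have := wp x0 xL; rewrite /energy; lra. Qed.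

Lemma integrable_energy : mu.-integrable `]0, L] (EFin \o energy w p).
Proof.
apply: measurable_bounded_integrable => //=.
- by rewrite lebesgue_measure_itv//=; case: ifPn => // _; rewrite -EFinB ltry.
- exact: measurable_energy.
exists (2 * M); split; first exact: num_real.
move=> m Mm x /=; rewrite in_itv/= => /andP[x0 xL].
apply: le_trans (ltW Mm); rewrite ler_norml.
have := energy_ge x0 xL; have := w2M (ltW x0) xL.
have := sqr_ge0 (w x); have : 0 <= w x ^+ 2 * p x ^+ 2.
  by rewrite mulr_ge0 ?sqr_ge0.
rewrite /energy; lra.
Qed.

Let integrable_sub (x y : R) : 0 <= x -> y <= L ->
  mu.-integrable `]x, y] (EFin \o energy w p).
Proof.
move=> x0 yL; apply: integrableS integrable_energy => //.
by apply: subset_itv; rewrite bnd_simp.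
Qed.

Let chasles (x y z : R) : 0 <= x -> x <= y -> y <= z -> z <= L ->
  I x z = I x y + I y z.
Proof.
move=> x0 xy yz zL; rewrite /I.
rewrite -(@Rintegral_itvB _ _ (BRight x) (BRight z) y) ?bnd_simp//.
  by rewrite addrC subrK.
exact: integrable_sub.
Qed.

Let I_ge_cst (c x y : R) : 0 <= x -> x <= y -> y <= L ->
  (forall t, x < t -> t < y -> c <= energy w p t) -> c * (y - x) <= I x y.
Proof.
by move=> x0 xy yL H; apply: Rintegral_ge_cst => //; exact: integrable_sub.
Qed.

Let I_ge (x y : R) : 0 <= x -> x <= y -> y <= L -> - (2 * M) * (y - x) <= I x y.
Proof.
move=> x0 xy yL; apply: I_ge_cst => // t xt ty.
have := energy_ge (le_lt_trans x0 xt) (ltW (lt_le_trans ty yL)).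
by have := sqr_ge0 (w t); lra.
Qed.

(** Each factor is frozen at the end where it is least favourable, which yields exactly the main
    term of [potential_step]. *)
Let I_ge_ends (x y : R) : 0 < x -> x <= y -> y <= L ->
  (2 * w x ^+ 2 - 4 * (w y ^+ 2 * p x ^+ 2)) * (y - x) <= I x y.
Proof.
move=> x0 xy yL; apply: I_ge_cst => //; first exact: ltW.
move=> t xt ty; have t0 := lt_trans x0 xt; have tL := ltW (lt_le_trans ty yL).
have h1 := w2_homo (ltW x0) (ltW xt) tL.
have h2 := w2_homo (ltW t0) (ltW ty) yL.
have h3 : p t ^+ 2 <= p x ^+ 2.
  by rewrite lerXn2r ?p_anti ?(ltW xt)// nnegrE p_ge0// (le_trans xy).
have := ler_pM (sqr_ge0 _) (sqr_ge0 _) h2 h3.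
rewrite /energy; lra.
Qed.

Lemma potential_le (a b : R) : 0 < a -> a <= b -> b <= L -> w b ^+ 2 < M ->
  potential M (w b) (p b) - potential M (w a) (p a) <=
  I a b - 2 * M / 3 * (b - a).
Proof.
move=> a0 ab bL wbM; have b0 := lt_le_trans a0 ab.
have bL' : b < L.
  by rewrite lt_neqAle bL andbT; apply/eqP => bE; rewrite bE wL ltxx in wbM.
have wbL : w b < w L.
  rewrite ltNge; apply/negP => wLb; move: wbM; apply/negP.
  by rewrite -leNgt -wL lerXn2r// nnegrE w_ge0// ltW.
(* If [p b] were not positive, [p_hi] would keep [w] from rising beyond [b], against [w b < w L]. *)
have pb0 : 0 < p b.
  rewrite ltNge; apply/negP => pb; have := p_hi b0 bL' (lexx L).
  by rewrite leNgt => /negP; apply; rewrite (@le_lt_trans _ _ 0) ?subr_gt0//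
    mulr_le0_ge0// subr_ge0.
(* A sum of nonnegative terms dominates each of them. It involves [p a] and [1 / p b], which is why
   the estimate stays away from [0] and from the points where [v = M]. *)
pose K := w L + M + p a + (p b)^-1.
have wL0 := w_ge0 (ltW L_gt0) (lexx L).
have pa0 := p_ge0 a0 (le_trans ab bL).
have pbV0 : 0 < (p b)^-1 by rewrite invr_gt0.
have [KwL KM Kpa KpbV] : [/\ w L <= K, M <= K, p a <= K & (p b)^-1 <= K].
  by have M0 := ltW M_gt0; rewrite /K; split; lra.
pose C := 4 / 3 * K ^+ 2 + 4 * K + 8 * K ^+ 3.
pose g x := C * (w x - p x).
pose h x := potential M (w x) (p x) - I 0 x + 2 * M / 3 * x.
have : h b <= h a.
  apply: (@ler_of_subquadratic_increments _ g) => // x y ax xy yb.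
  have x0 := lt_le_trans a0 ax; have y0 := lt_trans x0 xy.
  have yL := le_trans yb bL; have xL := ltW (lt_le_trans xy yL).
  have := I_ge_ends x0 (ltW xy) yL.
  have := chasles (lexx 0) (ltW x0) (ltW xy) yL.
  have : potential M (w y) (p y) - potential M (w x) (p x) <=
      (y - x) * (2 * w x ^+ 2 - 4 * (w y ^+ 2 * p x ^+ 2) - 2 * M / 3)
      + (y - x) * (C * ((w y - w x) + (p x - p y))).
    have py0 : p b <= p y by exact: p_anti.
    have pxa : p x <= p a by exact: p_anti.
    have wyL : w y <= w L by rewrite w_homo// ltW.
    apply: (@potential_step _ K).
    - by rewrite subr_ge0 ltW.
    - by rewrite w_ge0// ltW.
    - by rewrite w_homo// ltW.
    - exact: le_trans KwL.
    - exact: KM.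
    - by rewrite w2M// ltW.
    - exact: lt_le_trans py0.
    - by rewrite p_anti// ltW.
    - exact: le_trans Kpa.
    - apply: le_trans KpbV.
      by rewrite lef_pV2// posrE//; exact: lt_le_trans py0.
    - exact: wp.
    - exact: p_lo.
    - exact: p_hi.
  rewrite /h /g; lra.
have := chasles (lexx 0) (ltW a0) ab bL.
rewrite /h; lra.
Qed.

Let potential_le0 (x : R) : 0 < x -> x <= L -> potential M (w x) (p x) <= 0.
Proof.
move=> x0 xL; rewrite /potential.
have wx := w_ge0 (ltW x0) xL; have px := p_ge0 x0 xL.
have : 0 <= w x ^+ 3 * p x by rewrite mulr_ge0// exprn_ge0.
have : 0 <= w x * (M - w x ^+ 2) / p x.
  by rewrite mulr_ge0 ?invr_ge0// mulr_ge0// subr_ge0 w2M// ltW.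
have -> : 2 / 3 * (w x ^+ 3 - M * w x) / p x =
  - (2 / 3 * (w x * (M - w x ^+ 2) / p x)) by ring.
lra.
Qed.

(* [c] is a point where [w] has reached its maximum, so that
   [w c - w b <= p b * (c - b)] compensates the factor [1 / p b]. *)
Let potential_ge (b c : R) : 0 < b -> b < c -> c <= L -> w c ^+ 2 = M ->
  - (4 / 3 * M * (c - b)) - 4 / 3 * M * (w b * p b) <=
  potential M (w b) (p b).
Proof.
move=> b0 bc cL wcM; have bL := ltW (lt_le_trans bc cL).
have wb := w_ge0 (ltW b0) bL; have pb := p_ge0 b0 bL.
have wbc := w_homo (ltW b0) (ltW bc) cL.
have wbM := w2M (ltW b0) bL.
have : w b ^+ 3 * p b <= M * (w b * p b).
  have -> : w b ^+ 3 * p b = w b ^+ 2 * (w b * p b) by ring.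
  by rewrite ler_wpM2r// mulr_ge0.
have : w b * (M - w b ^+ 2) / p b <= 2 * M * (c - b).
  (* When [p b = 0] the quotient is [0] by the convention on inverses. *)
  have [pb0|pb0] := eqVneq (p b) 0.
    by rewrite pb0 invr0 mulr0 !mulr_ge0 ?(ltW M_gt0)// subr_ge0 ltW.
  rewrite ler_pdivrMr ?lt0r ?pb0//.
  have -> : M - w b ^+ 2 = (w c - w b) * (w c + w b) by rewrite -subr_sqr wcM.
  have H : w b * (w c + w b) <= 2 * M.
    have : w b * w c <= w c ^+ 2 by rewrite expr2 ler_wpM2r// (le_trans wb).
    by rewrite wcM; lra.
  have := p_hi b0 bc cL.
  have -> : 2 * M * (c - b) * p b = p b * (c - b) * (2 * M) by ring.
  have -> : w b * ((w c - w b) * (w c + w b)) =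
    (w c - w b) * (w b * (w c + w b)) by ring.
  move=> H'; apply: ler_pM => //; first by rewrite subr_ge0.
  by rewrite mulr_ge0// addr_ge0// (le_trans wb).
have -> : potential M (w b) (p b) =
  - (2 / 3 * (w b * (M - w b ^+ 2) / p b)) - 4 / 3 * (w b ^+ 3 * p b).
  by rewrite /potential; ring.
lra.
Qed.

(** The supremum [D] of the points where [w ^+ 2 < M] is bracketed: [b] is such a point just below
    [D], and [c] lies just above it or is [L]. The square in [d ^+ 2] makes [w b * p b] of order [d]
    through [wp]. *)
Let bracket_max (d : R) : 0 < d -> exists b c : R,
  [/\ 0 < b, b < c, c <= L, c - b <= d & 
   [/\ w b ^+ 2 < M, M - w b ^+ 2 <= d ^+ 2 & w c ^+ 2 = M]].
Proof.
move=> d0; have [e1 e10 H1] := w_unif M_gt0.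
have [e2 e20 H2] := w_unif (exprn_gt0 2 d0).
pose A := [set x | 0 <= x <= L /\ w x ^+ 2 < M].
have A0 : A 0 by split; rewrite ?lexx ?(ltW L_gt0)// w0 expr0n/=.
have ubA : ubound A L by move=> x [/andP[]].
have supA : has_sup A by split; [exists 0|exists L].
pose D := sup A.
have DL : D <= L by apply: ge_sup => //; exists 0.
have D0 : 0 < D.
  pose m := Num.min (e1 / 2) L.
  have m0 : 0 < m by rewrite lt_min L_gt0 divr_gt0.
  apply: (lt_le_trans m0); apply: ub_le_sup; first by exists L.
  have me : m <= e1 / 2 by rewrite ge_min lexx.
  have mL : m <= L by rewrite ge_min lexx orbT.
  split; first by rewrite mL ltW.
  have := H1 0 m (lexx 0) (ltW m0) mL; rewrite w0 expr0n/= !subr0; apply.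
  by lra.
(* With a third of the minimum, [D - m < b] gives [0 < b], and [c - b <= 2 * m] stays within [d] and
   strictly below [e2]. *)
pose m := Num.min D (Num.min d e2) / 3.
have m0 : 0 < m by rewrite divr_gt0// !lt_min D0 d0.
have mD : m * 3 <= D by rewrite divfK// ge_min lexx.
have md : m * 3 <= d by rewrite divfK// !ge_min lexx orbT.
have me : m * 3 <= e2 by rewrite divfK// !ge_min lexx !orbT.
have [b [/andP[b0 bL] wb] bD] := sup_adherent m0 supA.
have bD' : b <= D by apply: ub_le_sup; [exists L|split => //; rewrite b0].
have b0' : 0 < b by rewrite -/D in bD; lra.
have [c [bc cL cb wc]] : exists c, [/\ b < c, c <= L, c - b <= 2 * m &
    w c ^+ 2 = M].
  (* If [D + m] is still in the domain, it lies beyond the supremum, so the maximum is attained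
     there; otherwise [L] is close enough. *)
  have [DmL|LDm] := leP (D + m) L.
    exists (D + m); split => //; [lra|rewrite -/D in bD; lra|].
    apply/eqP; rewrite eq_le w2M//; last lra.
    rewrite /= leNgt; apply/negP => H.
    have : D + m <= D; last lra.
    by apply: ub_le_sup; [exists L|split => //; rewrite DmL andbT; lra].
  exists L; split => //; last by rewrite -/D in bD; lra.
  by rewrite lt_neqAle bL andbT; apply/eqP => bE; rewrite bE wL ltxx in wb.
exists b, c; split => //; first lra.
split => //; rewrite -wc ltW// H2// ?(ltW bc)//; lra.
Qed.

(** The interval is cut at [a], [b], [c]: the potential handles [[a, b]], the pieces [[0, a]] and
    [[b, c]] are short, and beyond [c] the integrand is at least [2 * M]. *)
Lemma energy_integral_ge : 2 * M / 3 * L <= I 0 L.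
Proof.
(* Since [a], [c - b] and [w b * p b] are at most [d], their losses are at most [8/3], [4] and [4/3]
   times [M * d], within [10 * M * d]. *)
apply/ler_addgt0Pl => e e0; pose d := Num.min (e / (10 * M)) 1.
have d0 : 0 < d by rewrite lt_min ltr01 divr_gt0// mulr_gt0.
have de : 10 * M * d <= e.
  have : d <= e / (10 * M) by rewrite ge_min lexx.
  by rewrite ler_pdivlMr ?mulr_gt0// mulrC.
have [b [c [b0 bc cL cbd [wbM wbd wcM]]]] := bracket_max d0.
pose a := Num.min b d.
have a0 : 0 < a by rewrite lt_min b0.
have ab : a <= b by rewrite ge_min lexx.
have ad : a <= d by rewrite ge_min lexx orbT.
have bL := ltW (lt_le_trans bc cL).
have aL := le_trans ab bL.
have c0 := lt_trans b0 bc.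
have wpb : w b * p b <= d.
  rewrite -(@ler_pXn2r _ 2) ?nnegrE ?(ltW d0)//; last first.
    by rewrite mulr_ge0 ?p_ge0 ?w_ge0// ltW.
  by rewrite exprMn; have := wp b0 bL; have := sqr_ge0 (w b * p b);
    rewrite exprMn; lra.
have := potential_le a0 ab bL wbM.
have := potential_le0 a0 aL.
have := potential_ge b0 bc cL wcM.
have := I_ge (lexx 0) (ltW a0) aL.
have := I_ge (ltW b0) (ltW bc) cL.
have : 2 * M * (L - c) <= I c L.
  apply: I_ge_cst => //; first exact: ltW.
  move=> t ct tL; have := energy_ge (lt_trans c0 ct) (ltW tL).
  by have := w2_homo (ltW c0) (ltW ct) (ltW tL); rewrite wcM; lra.
have := chasles (lexx 0) (ltW a0) aL (lexx L).
have := chasles (ltW a0) ab bL (lexx L).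
have := chasles (ltW b0) (ltW bc) cL (lexx L).
have : M * (w b * p b) <= M * d by rewrite ler_pM2l.
have : M * (c - b) <= M * d by rewrite ler_pM2l.
have : M * a <= M * d by rewrite ler_pM2l.
have : 0 <= M * (L - c) by rewrite mulr_ge0 ?subr_ge0// ltW.
lra.
Qed.

End energy_bound.

(** * Transfer from [v] to [w] and [p], and conclusion *)

Lemma concave_function_itv (R : realType) (a b : R) (f : R -> R) :
  concave_function (`[a, b]%classic : set R) f ->
  forall x y z : R, a <= x -> x < y -> y < z -> z <= b ->
  (f z - f y) * (y - x) <= (f y - f x) * (z - y).
Proof.
move=> cf x y z ax xy yz zb; have xz := lt_trans xy yz.
have zx0 : 0 < z - x by rewrite subr_gt0.
(* The weight [t] falls on the left point [x], following the convention for [x <| t |> z]. *)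
pose t := (z - y) / (z - x).
have t0 : 0 <= t by rewrite divr_ge0// subr_ge0 ltW.
have t1 : t <= 1 by rewrite ler_pdivrMr// mul1r; lra.
have H : t * f x + (1 - t) * f z <= f (t * x + (1 - t) * z).
  by apply: (cf (Itv01 t0 t1)); rewrite inE/= in_itv/=;
    rewrite ?ax ?zb ?(le_trans ax (ltW xz))// (le_trans (ltW xz)).
move: H; have -> : t * x + (1 - t) * z = y by rewrite /t; field; lra.
move=> H.
have : (t * f x + (1 - t) * f z) * (z - x) <= f y * (z - x).
  by rewrite ler_pM2r.
have -> : (t * f x + (1 - t) * f z) * (z - x) =
    (z - y) * f x + (y - x) * f z.
  by rewrite /t; field; lra.
lra.
Qed.

Theorem lemma3p1 (R : realType) (L M : R) (v : R -> R)
    (L_gt0 : 0 < L) (M_gt0 : 0 < M)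
    (v_range : forall x : R, x \in `[0, L] -> v x \in `[0, M])
    (v_ac : absolutely_continuous_on 0 L v)
    (v0 : v 0 = 0) (vL : v L = M)
    (sqrtv_concave :
      concave_function (`[0, L]%classic : set R) (fun x : R => Num.sqrt (v x)))
    (sqrtv_nondecreasing :
      {in `[0, L] &, {homo (fun x : R => Num.sqrt (v x)) : x y / x <= y}})
    (v_deriv : {ae (@lebesgue_measure R), forall x : R,
      x \in `[0, L] -> (derive1 v x) ^+ 2 <= 2 * (M - v x)}) :
  \int[@lebesgue_measure R]_(x in `[0, L]) (2 * v x - (derive1 v x) ^+ 2)
    >= 2 * M / 3 * L.
Proof.
pose w (x : R) : R := Num.sqrt (v x); pose p := right_slope L w.
have w_ge0 (x : R) : 0 <= x -> x <= L -> 0 <= w x by rewrite sqrtr_ge0.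
have w2 (x : R) : 0 <= x -> x <= L -> w x ^+ 2 = v x.
  move=> x0 xL; rewrite sqr_sqrtr//.
  have := v_range x; rewrite !in_itv/= x0 xL => /(_ isT).
  by case/andP.
have w_conc := @concave_function_itv _ 0 L w sqrtv_concave.
have w_homo (x y : R) : 0 <= x -> x <= y -> y <= L -> w x <= w y.
  move=> x0 xy yL; apply: sqrtv_nondecreasing => //.
    by rewrite in_itv/= x0 (le_trans xy).
  by rewrite in_itv/= yL (le_trans x0).
have v_unif := absolutely_continuous_on_uniform v_ac.
have p_ge0 (x : R) : 0 < x -> x <= L -> 0 <= p x.
  exact: (right_slope_ge0 w_conc w_homo).
have p_anti (x y : R) : 0 < x -> x <= y -> y <= L -> p y <= p x.
  exact: (right_slope_anti w_conc w_homo).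
have p_lo (x y : R) : 0 < x -> x < y -> y <= L -> p y * (y - x) <= w y - w x.
  move=> x0 xy yL; rewrite -ler_pdivlMr ?subr_gt0//.
  exact: (right_slope_le w_conc w_homo (ltW x0) xy yL).
have p_hi (x y : R) : 0 < x -> x < y -> y <= L -> w y - w x <= p x * (y - x).
  move=> x0 xy yL; rewrite -ler_pdivrMr ?subr_gt0//.
  exact: (slope_le_right w_conc).
have dv (x : R) : 0 < x -> x < L -> ~ kinks L w x -> derive1 v x = 2 * (w x * p x).
  move=> x0 xL nk; rewrite derive1E.
  have dw := is_derive_right_slope w_conc w_homo x0 xL nk.
  have dw2 : is_derive x 1 (fun y => w y ^+ 2) (2 * (w x * p x)).
    have := is_deriveX 2 dw; rewrite exprfctE => dw2.
    apply: (is_derive_eq dw2).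
    by rewrite expr1 [_ *: _]mulrC mulrC -mulrA.
  suff dv : is_derive x 1 v (2 * (w x * p x)) by exact: derive_val.
  apply: near_eq_is_derive dw2.
  have : \forall y \near x, y \in `]0, L[.
    by apply: near_in_itvoo; rewrite in_itv/= x0.
  apply: filterS => y; rewrite in_itv/= => /andP[y0 yL].
  by rewrite w2// ltW.
have energyE (x : R) : 0 < x -> x < L -> ~ kinks L w x ->
    2 * v x - derive1 v x ^+ 2 = energy w p x.
  move=> x0 xL nk; rewrite dv// -w2 ?ltW// /energy; ring.
have ae_nk : {ae @lebesgue_measure R, forall x, ~ kinks L w x}.
  exists (kinks L w); split.
  - apply: countable_measurable; first exact: measurable_set1.
    exact: countable_kinks.
  - by apply: countable_lebesgue_measure0; exact: countable_kinks.
  - by move=> x /contrapT.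
(* The almost everywhere bound passes to every point, [L] included, by approaching [x] from the left
   through good points [y]: there [p y >= p x], while [v y] is close to [v x]. With [c] the claim
   reads [v x * c <= M]. *)
have wp (x : R) : 0 < x -> x <= L -> 2 * w x ^+ 2 * p x ^+ 2 <= M - w x ^+ 2.
  move=> x0 xL; rewrite w2 ?(ltW x0)//.
  have px0 : 0 <= p x := p_ge0 _ x0 xL.
  pose c := 1 + 2 * p x ^+ 2.
  have c0 : 0 < c by rewrite ltr_wpDr// mulr_ge0// sqr_ge0.
  suff : v x * c <= M by rewrite /c; lra.
  apply/ler_addgt0Pr => e e0.
  have [d d0 vd] := v_unif (e / c) (divr_gt0 e0 c0).
  have : Num.max 0 (x - d) < x by rewrite gt_max x0/= gtrBl.
  have ae2 : {ae @lebesgue_measure R, forall y, ~ kinks L w y /\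
      (y \in `[0, L] -> derive1 v y ^+ 2 <= 2 * (M - v y))}.
    by apply: (@filterS2 _ _ (ae_filter_ringOfSetsType _)) ae_nk v_deriv => y.
  move=> /(ae_itv_ex ae2)[y []].
  rewrite gt_max => /andP[y0 xdy] yx [nk vy].
  have yL := lt_le_trans yx xL.
  have := vy; rewrite in_itv/= (ltW y0) (ltW yL) => /(_ isT).
  rewrite dv// => vy'.
  have pp : p x ^+ 2 <= p y ^+ 2.
    by rewrite lerXn2r ?nnegrE ?p_anti ?p_ge0// ltW.
  have vy0 : 0 <= v y by rewrite -w2 ?sqr_ge0 ?ltW.
  have := ler_wpM2l vy0 pp.
  have : `|v x - v y| < e / c by apply: (vd _ _ (ltW y0) (ltW yx) xL); lra.
  rewrite ltr_norml => /andP[_]; rewrite ltr_pdivlMr//.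
  move: vy'; rewrite !exprMn (w2 _ (ltW y0) (ltW yL)) /c; lra.
have w0 : w 0 = 0 by rewrite /w v0 sqrtr0.
have wL : w L ^+ 2 = M by rewrite w2// ltW.
have w_unif (e : R) : 0 < e -> exists2 d : R, 0 < d &
    forall x y : R, 0 <= x -> x <= y -> y <= L -> y - x < d ->
    w y ^+ 2 - w x ^+ 2 < e.
  move=> /v_unif[d d0 vd]; exists d => // x y x0 xy yL xyd.
  rewrite !w2 ?(le_trans x0)// ?(le_trans xy)//.
  by rewrite (le_lt_trans (ler_norm _))// vd.
have mE := measurable_energy w_homo p_anti.
(* [L] joins the kinks because the two-sided derivative there depends on values of [v] outside the
   interval. *)
pose A := \bigcup_(b in [set: bool]) if b then kinks L w else [set L].
have cA : countable A.
  apply: bigcup_countable; first exact: countableP.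
  by move=> [] _; [exact: countable_kinks|exact: countable1].
have eqA (x : R) : (`]0, L] `\` A) x -> 2 * v x - derive1 v x ^+ 2 = energy w p x.
  move=> [/=]; rewrite in_itv/= => /andP[x0 xL] nA.
  apply: energyE => //; last by move=> kx; apply: nA; exists true.
  rewrite lt_neqAle xL andbT; apply/eqP => xE; apply: nA.
  by exists false.
have mv : measurable_fun `]0, L] (fun x => 2 * v x - derive1 v x ^+ 2).
  apply: (measurable_fun_setD_countable _ cA) => //.
  apply: (@eq_measurable_fun _ _ _ _ _ (energy w p)).
    by move=> x /set_mem /eqA.
  by apply: measurable_funS mE => // x [].
have -> : \int[@lebesgue_measure R]_(x in `[0, L]) (2 * v x - derive1 v x ^+ 2) =
    \int[@lebesgue_measure R]_(x in `]0, L]) energy w p x.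
  rewrite /Rintegral -integral_itv_obnd_cbnd; last exact/measurable_EFinP.
  congr fine; apply: ae_eq_integral => //; try exact/measurable_EFinP.
  exists A; split.
  - by apply: countable_measurable => //; exact: measurable_set1.
  - exact: countable_lebesgue_measure0.
  - move=> x /= /not_implyP[xL neq]; apply: contrapT => nA; apply: neq.
    by congr EFin; apply: eqA.
exact: energy_integral_ge.
Qed.
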